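(* Let $r \ge 3$ be an integer and let $H$ be an intersecting $r$-segment hypergraph. Then $H$ contains an isolated vertex, i.e. a vertex lying in only one edge of $H$. In particular, $\tau(H) \le r-1$.
   Context: A hypergraph $H=(V,E)$ consists of a vertex set $V$ and an edge set $E \subset 2^V$. For an integer $r \ge 2$, a hypergraph $H=(V,E)$ with $V \subset \mathbb{Z}^2$ is an $r$-segment hypergraph if (i) every edge in $E$ consists of $r$ consecutive integer points (points of $\mathbb{Z}^2$) on some line in $\mathbb{R}^2$, and (ii) every line in $\mathbb{R}^2$ contains at most one edge of $H$. The matching number $\nu(H)$ is the maximum number of pairwise disjoint edges of $H$; $H$ is intersecting if $\nu(H)=1$ (so $H$ has at least one edge and any two edges share a vertex). A cover of $H$ is a set of vertices meeting every edge; the covering number $\tau(H)$ is the minimum size of a cover. An isolated vertex is a vertex lying in exactly one edge. *)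

(* Defs.v *)
From HB Require Import structures.
From mathcomp Require Import all_boot all_order all_algebra.
From mathcomp Require Import all_classical all_reals.
Set Implicit Arguments.
Unset Strict Implicit.
Unset Printing Implicit Defensive.
Import Order.TTheory GRing.Theory Num.Theory.

Local Open Scope classical_set_scope.
Local Open Scope ring_scope.
Local Open Scope card_scope.

(* Neither the vertex set nor the edge set is assumed to be finite. *)
Record hypergraph (T : Type) : Type := Hypergraph {
  vertices : set T;
  edges : set (set T);
  edges_sub : forall e, edges e -> e `<=` vertices
}.

Definition is_matching (T : Type) (H : hypergraph T) (M : set (set T)) : Prop :=
  M `<=` edges H /\
  (forall e f, M e -> M f -> e <> f -> e `&` f = set0).

Definition is_cover (T : Type) (H : hypergraph T) (C : set T) : Prop :=
  C `<=` vertices H /\ (forall e, edges H e -> e `&` C !=set0).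

(* nu(H) and tau(H) are relations "nu(H) = n" and "tau(H) = n": on an infinite
   hypergraph neither number need be finite.  The comparisons [#<=] range over
   infinite matchings and covers too. *)
Definition matching_number (T : Type) (H : hypergraph T) (n : nat) : Prop :=
  (exists2 M, is_matching H M & M #= `I_n) /\
  (forall M, is_matching H M -> M #<= `I_n).

Definition covering_number (T : Type) (H : hypergraph T) (n : nat) : Prop :=
  (exists2 C, is_cover H C & C #= `I_n) /\
  (forall C, is_cover H C -> `I_n #<= C).

Definition intersecting (T : Type) (H : hypergraph T) : Prop :=
  matching_number H 1.

Definition isolated_vertex (T : Type) (H : hypergraph T) (v : T) : Prop :=
  vertices H v /\ (exists! e, edges H e /\ e v).

Definition is_line (R : realType) (L : set (R * R)) : Prop :=
  exists a b c : R, (a, b) != (0, 0) /\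
    L = [set x | a * x.1 + b * x.2 = c].

Definition segment (R : realType) (x y : R * R) : set (R * R) :=
  [set z | exists t : R, 0 <= t <= 1 /\
     z = (x.1 + t * (y.1 - x.1), x.2 + t * (y.2 - x.2))].

Definition to_plane (R : realType) (p : int * int) : R * R :=
  (p.1%:~R, p.2%:~R).

(* [e] is contained in the line [L], seen in R^2. *)
Definition in_line (R : realType) (L : set (R * R)) (e : set (int * int)) :
    Prop :=
  forall p, e p -> L (to_plane R p).

(* Points of Z^2 on a line are consecutive when no point of Z^2 lying between
   two of them is left out. *)
Definition consecutive_points (R : realType) (r : nat) (L : set (R * R))
    (e : set (int * int)) : Prop :=
  [/\ in_line L e,
      e #= `I_r &
      forall p q z : int * int, e p -> e q ->
        segment (to_plane R p) (to_plane R q) (to_plane R z) -> e z].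

Definition segment_hypergraph (R : realType) (r : nat)
    (H : hypergraph (int * int)) : Prop :=
  (forall e, edges H e ->
     exists2 L : set (R * R), is_line L & consecutive_points r L e) /\
  (forall L : set (R * R), is_line L ->
     forall e f, edges H e -> edges H f -> in_line L e -> in_line L f -> e = f).

(* Main.v *)
(* Suppose that every vertex lies on two edges.  Take two points p, q of an
   edge and a vertex s off its line spanning the least area N.  Two edges
   through s meet that of p and q, and by minimality they can be chosen to meet
   it in neighbouring points; this gives a triangle a, b, c of area N whose
   sides lie on three edges, and minimality forces the points of those edges to
   have integer affine coordinates along the sides.  By Menelaus, an edge that
   crosses the three side lines at x, y, z satisfies
   x y z = (x - 1) (y - 1) (z - 1).  An edge has a third point, say
   d = 2b - a.  At x = 2 the equation is (y + 1) (z + 1) = 2, so a second edge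
   through d either passes through c or has {y, z} = {-2, -3}.  In the first
   case a third point of the edge of b, c lies on no second edge, since
   triangles abc and bdc require it to meet the line ab at different points.
   In the second case 2b - c is a vertex too, and the second edges through d and
   2b - c meet at positive distance from the line ab, but closer than c. *)

Require Import Defs.
From mathcomp Require Import all_boot all_order all_algebra.
From mathcomp Require Import all_classical all_reals.
From mathcomp Require Import zify ring.
Set Implicit Arguments.
Unset Strict Implicit.
Unset Printing Implicit Defensive.
Import Order.TTheory GRing.Theory Num.Theory.

Local Open Scope classical_set_scope.
Local Open Scope ring_scope.
Local Open Scope card_scope.

(** * Lattice areas, affine coordinates and the configuration to refute *)

Notation point := (int * int)%type.

(** Twice the signed area of the triangle [p], [q], [s]: an integer that vanishes exactly on
    collinear triples. *)
Definition cross (p q s : point) : int :=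
  (q.1 - p.1) * (s.2 - p.2) - (q.2 - p.2) * (s.1 - p.1).

Definition along (p q : point) (t : int) : point :=
  (p.1 + t * (q.1 - p.1), p.2 + t * (q.2 - p.2)).

(* What the edges of a counterexample would satisfy; [m / n] in [cs_convex] is
   the position of [z] on the segment from [p] to [q]. *)
Record crossing_system (E : set (set point)) : Prop := CrossingSystem {
  cs_nonempty : exists e, E e;
  cs_meet : forall e f, E e -> E f -> exists2 p, e p & f p;
  cs_line : forall e f p q s, E e -> E f -> e p -> e q -> p <> q ->
    f p -> f s -> s <> p -> cross p q s = 0 -> e = f;
  cs_collinear : forall e p q s, E e -> e p -> e q -> e s -> cross p q s = 0;
  cs_convex : forall e p q z (m n : int), E e -> e p -> e q ->
    0 <= m <= n -> 0 < n ->
    n * (z.1 - p.1) = m * (q.1 - p.1) -> n * (z.2 - p.2) = m * (q.2 - p.2) ->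
    e z;
  cs_third : forall e p q, E e -> e p -> e q ->
    exists s, [/\ e s, s <> p & s <> q];
  cs_crossed : forall e p, E e -> e p -> exists f, [/\ E f, f p & f <> e]
}.

(** [N] is only a lower bound here; that a triangle attains it is stated separately, as in
    [ut_area]. *)
Definition min_area (E : set (set point)) (N : int) : Prop :=
  0 < N /\ (forall e f p q s, E e -> E f -> e p -> e q -> f s ->
    cross p q s <> 0 -> N <= `|cross p q s|).

Lemma point_neq (p q : point) :
  p <> q -> q.1 - p.1 <> 0 \/ q.2 - p.2 <> 0.
Proof.
case: p q => [a b] [c d] /= pq.
have [ac|ac] := eqVneq a c; last by left; lia.
right=> db; apply: pq; congr (_, _) => //; lia.
Qed.

Lemma cross_neq0 (p q s : point) :
  cross p q s <> 0 -> [/\ p <> q, q <> s & s <> p].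
Proof.
by move=> h; split=> eq; apply: h; rewrite eq /cross; ring.
Qed.

Lemma mulf_eq0_cancel (R : idomainType) (x y : R) : x * y = 0 -> x <> 0 -> y = 0.
Proof. by move=> /eqP; rewrite mulf_eq0 => /orP[/eqP//|/eqP]. Qed.

Lemma cs_uniq E e f p q : crossing_system E -> E e -> E f ->
  e p -> e q -> f p -> f q -> p <> q -> e = f.
Proof.
move=> cs Ee Ef ep eq_ fp fq pq.
apply: (cs_line cs Ee Ef ep eq_ pq fp fq); first by move/esym.
by rewrite /cross; ring.
Qed.

Lemma along_convex E e p q (t m : int) : crossing_system E -> E e ->
  e p -> e (along p q t) -> (0 <= m <= t) || (t <= m <= 0) ->
  e (along p q m).
Proof.
move=> cs Ee ep et hm.
have [t0|t0] := eqVneq t 0.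
  suff -> : m = t by [].
  lia.
have [tp|tn] : 0 < t \/ t < 0 by lia.
  by apply: (@cs_convex _ cs e p _ _ m t Ee ep et); [lia|lia|rewrite /=; ring..].
by apply: (@cs_convex _ cs e p _ _ (- m) (- t) Ee ep et);
  [lia|lia|rewrite /=; ring..].
Qed.

Lemma min_area_step E N e f p q s x : crossing_system E -> min_area E N ->
  E e -> E f -> e p -> e q -> f s -> e x -> `|cross p q s| = N ->
  exists t, x = along p q t.
Proof.
move=> cs [N0 minN] Ee Ef ep eq_ fs ex hN.
pose u1 := q.1 - p.1; pose u2 := q.2 - p.2.
pose w1 := x.1 - p.1; pose w2 := x.2 - p.2.
have hcol : u1 * w2 = u2 * w1.
  by have := cs_collinear cs Ee ep eq_ ex; rewrite /cross => /subr0_eq.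
pose n := u1 ^+ 2 + u2 ^+ 2.
have n0 : 0 < n.
  have : cross p q s <> 0 by lia.
  case/cross_neq0 => /point_neq; rewrite -/u1 -/u2 => h _ _.
  rewrite /n; nia.
(* Euclidean division of the projection of [x - p] on [q - p]: the remainder
   gives a point [z] of the edge on the segment [p q], distinct from [q], so
   [p], [z], [s] span an area less than [N] and [z = p]. *)
pose d := u1 * w1 + u2 * w2.
pose t := (d %/ n)%Z; pose m := (d %% n)%Z.
have dE : d = t * n + m by exact: divz_eq.
have m0 : 0 <= m by apply: modz_ge0; lia.
have mn : m < n by apply: ltz_pmod.
exists t.
pose z : point := (x.1 - t * u1, x.2 - t * u2).
(* By collinearity [n (x - p) = d (q - p)], so [z] lies at position [m / n] between [p] and [q]. *)
have z1 : n * (z.1 - p.1) = m * u1.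
  have -> : m = d - t * n by lia.
  rewrite /z /= /d /n.
  transitivity ((u1 ^+ 2 + u2 ^+ 2) * w1 - t * (u1 ^+ 2 + u2 ^+ 2) * u1).
    by rewrite /w1; ring.
  have -> : (u1 * w1 + u2 * w2 - t * (u1 ^+ 2 + u2 ^+ 2)) * u1 =
    u1 ^+ 2 * w1 + u2 * (u1 * w2) - t * (u1 ^+ 2 + u2 ^+ 2) * u1 by ring.
  by rewrite hcol; ring.
have z2 : n * (z.2 - p.2) = m * u2.
  have -> : m = d - t * n by lia.
  rewrite /z /= /d /n.
  transitivity ((u1 ^+ 2 + u2 ^+ 2) * w2 - t * (u1 ^+ 2 + u2 ^+ 2) * u2).
    by rewrite /w2; ring.
  have -> : (u1 * w1 + u2 * w2 - t * (u1 ^+ 2 + u2 ^+ 2)) * u2 =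
    u1 * (u2 * w1) + u2 ^+ 2 * w2 - t * (u1 ^+ 2 + u2 ^+ 2) * u2 by ring.
  by rewrite -hcol; ring.
have ez : e z.
  by apply: (@cs_convex _ cs e p q z m n) => //; lia.
have area : n * cross p z s = m * cross p q s.
  have -> : n * cross p z s =
    n * (z.1 - p.1) * (s.2 - p.2) - n * (z.2 - p.2) * (s.1 - p.1).
    by rewrite /cross; ring.
  by rewrite z1 z2 /cross /u1 /u2; ring.
have small : cross p z s = 0.
  apply: contrapT => /(minN _ _ _ _ _ Ee Ef ep ez fs) big.
  have : n * `|cross p z s| = m * N.
    by rewrite -hN -{1}(gtr0_norm n0) -normrM area normrM (ger0_norm m0).
  nia.
have m_eq0 : m = 0.
  have : m * cross p q s = 0 by rewrite -area small; ring.
  move=> /eqP; rewrite mulf_eq0 => /orP[/eqP//|/eqP]; lia.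
have e1 : z.1 - p.1 = 0 by apply: (mulf_eq0_cancel (x := n)); [rewrite z1 m_eq0; ring|lia].
have e2 : z.2 - p.2 = 0 by apply: (mulf_eq0_cancel (x := n)); [rewrite z2 m_eq0; ring|lia].
rewrite [LHS]surjective_pairing /along.
by congr (_, _); move: e1 e2; rewrite /z /= -/u1 -/u2; lia.
Qed.

(** * Triangles of minimal area with sides on edges, and their impossibility *)

Record unit_triangle (E : set (set point)) (N : int) (e1 e2 e3 : set point) (a b c : point)
    : Prop := UnitTriangle {
  ut_E1 : E e1; ut_E2 : E e2; ut_E3 : E e3;
  ut_a1 : e1 a; ut_b1 : e1 b;
  ut_b2 : e2 b; ut_c2 : e2 c;
  ut_c3 : e3 c; ut_a3 : e3 a;
  ut_area : `|cross a b c| = N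
}.

Lemma unit_triangle_rot E N e1 e2 e3 a b c :
  unit_triangle E N e1 e2 e3 a b c -> unit_triangle E N e2 e3 e1 b c a.
Proof.
case=> *; split=> //.
suff -> : cross b c a = cross a b c by [].
by rewrite /cross; ring.
Qed.

Lemma unit_triangle_sym E N e1 e2 e3 a b c :
  unit_triangle E N e1 e2 e3 a b c -> unit_triangle E N e1 e3 e2 b a c.
Proof.
case=> *; split=> //.
suff -> : cross b a c = - cross a b c by rewrite normrN.
by rewrite /cross; ring.
Qed.

Section Triangle.
Context (E : set (set point)) (N : int).
Hypotheses (cs : crossing_system E) (minN : min_area E N).

Lemma unit_triangle_along e1 e2 e3 a b c x :
  unit_triangle E N e1 e2 e3 a b c -> e1 x -> exists t, x = along a b t.
Proof.
case=> E1 E2 _ a1 b1 _ c2 _ _ ar x1.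
exact: (min_area_step cs minN E1 E2 a1 b1 c2 x1 ar).
Qed.

Lemma unit_triangle_neq0 e1 e2 e3 a b c :
  unit_triangle E N e1 e2 e3 a b c -> cross a b c <> 0.
Proof. by case: minN => N0 _ [] *; lia. Qed.

Lemma unit_triangle_edges_neq e1 e2 e3 a b c :
  unit_triangle E N e1 e2 e3 a b c -> e1 <> e2.
Proof.
move=> T e12; apply: (unit_triangle_neq0 T).
case: T; rewrite -e12 => E1 _ _ a1 b1 _ c1 _ _ _.
exact: (cs_collinear cs E1).
Qed.

(** The edge [g] meets [e2] and [e3] at integer coordinates [y] and [z]. The area spanned by the
    three points is [cross a b c] times the difference of the two sides of the equation, and
    collinearity makes it vanish. *)
Lemma menelaus e1 e2 e3 a b c g x :
  unit_triangle E N e1 e2 e3 a b c -> E g -> g (along a b x) ->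
  exists y z, [/\ g (along b c y), g (along c a z),
    e2 (along b c y), e3 (along c a z)
    & x * y * z = (x - 1) * (y - 1) * (z - 1)].
Proof.
move=> T Eg gx.
have [Y gY e2Y] := cs_meet cs Eg (ut_E2 T).
have [Z gZ e3Z] := cs_meet cs Eg (ut_E3 T).
have [y Yy] := unit_triangle_along (unit_triangle_rot T) e2Y.
have [z Zz] := unit_triangle_along (unit_triangle_rot (unit_triangle_rot T)) e3Z.
rewrite {}Yy in gY e2Y; rewrite {}Zz in gZ e3Z.
exists y, z; split=> //.
have := cs_collinear cs Eg gx gY gZ.
have -> : cross (along a b x) (along b c y) (along c a z) =
  cross a b c * (x * y * z - (x - 1) * (y - 1) * (z - 1)).
  by rewrite /cross /along /=; ring.
by move=> /mulf_eq0_cancel /(_ (unit_triangle_neq0 T)) /subr0_eq.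
Qed.

(** For [x = 2] the relation becomes [(y + 1) (z + 1) = 2], with four integer solutions. The
    solution [y = 0], [z = 1] would put [a] on [g] and force [g = e1]. *)
Lemma menelaus2 e1 e2 e3 a b c g :
  unit_triangle E N e1 e2 e3 a b c -> E g -> g <> e1 ->
  e1 (along a b 2) -> g (along a b 2) ->
  exists y z, [/\ g (along b c y), g (along c a z),
    e2 (along b c y), e3 (along c a z)
    & [\/ y = 1 /\ z = 0, y = -2 /\ z = -3 | y = -3 /\ z = -2]].
Proof.
move=> T Eg ge1 e12 g2.
have [y [z [gy gz ey ez yz]]] := menelaus T Eg g2.
exists y, z; split=> //.
have prod2 : (y + 1) * (z + 1) = 2 by lia.
have z1 : z <> 1.
  move=> z1; apply: ge1.
  have az : along c a z = a by rewrite /along z1; case: (a) => ? ? /=; congr (_, _); ring.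
  rewrite az in gz.
  apply: (cs_uniq cs Eg (ut_E1 T) g2 gz e12 (ut_a1 T)) => eqa.
  have [] := cross_neq0 (unit_triangle_neq0 T).
  move=> /point_neq ab _ _; move: eqa ab; rewrite /along.
  by case: (a) (b) => [? ?] [? ?] /= [] /=; lia.
have yb : -3 <= y <= 1.
  suff : `|y + 1| <= 2 by lia.
  have : `|y + 1| * `|z + 1| = 2 by rewrite -normrM prod2.
  have := normr_ge0 (y + 1); have := normr_ge0 (z + 1).
  move: `|y + 1| `|z + 1| => k l.
  by have [->|] : l = 0 \/ 1 <= l \/ l < 0; [lia|lia|nia].
have : [\/ y = -3, y = -2, y = -1 | y = 0 \/ y = 1].
  have [?|[?|[?|[?|?]]]] : y = -3 \/ y = -2 \/ y = -1 \/ y = 0 \/ y = 1 by lia.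
  - by constructor 1.
  - by constructor 2.
  - by constructor 3.
  - by constructor 4; left.
  - by constructor 4; right.
case=> [y3|y3|y3|[y3|y3]]; rewrite y3 in prod2 *.
- by constructor 3; split=> //; lia.
- by constructor 2; split=> //; lia.
- lia.
- lia.
- by constructor 1; split=> //; lia.
Qed.

Lemma along0 (p q : point) : along p q 0 = p.
Proof. by rewrite /along; case: p => ? ? /=; congr (_, _); ring. Qed.

Lemma along1 (p q : point) : along p q 1 = q.
Proof. by rewrite /along; case: q => ? ? /=; congr (_, _); ring. Qed.

Lemma alongC (p q : point) t : along q p t = along p q (1 - t).
Proof. by rewrite /along; congr (_, _); ring. Qed.

Lemma along_inj (p q : point) s t : p <> q -> along p q s = along p q t -> s = t.
Proof.
move=> /point_neq pq [] h1 h2; apply/subr0_eq.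
by case: pq => pq; apply: mulf_eq0_cancel pq; lia.
Qed.

(** A third point of [e1] has integer coordinate at least 2 or at most -1 on [a b]; convexity then
    supplies the point at 2 or at -1. *)
Lemma unit_triangle_third e1 e2 e3 a b c :
  unit_triangle E N e1 e2 e3 a b c -> e1 (along a b 2) \/ e1 (along b a 2).
Proof.
move=> T; have [s [e1s sa sb]] := cs_third cs (ut_E1 T) (ut_a1 T) (ut_b1 T).
have [t st] := unit_triangle_along T e1s; rewrite {}st in e1s sa sb.
have t0 : t <> 0 by move=> t0; apply: sa; rewrite t0 along0.
have t1 : t <> 1 by move=> t1; apply: sb; rewrite t1 along1.
have [t2|t2] : 2 <= t \/ t <= -1 by lia.
  by left; apply: (along_convex (t := t) cs (ut_E1 T) (ut_a1 T)) => //; lia.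
right; rewrite alongC.
by apply: (along_convex (t := t) cs (ut_E1 T) (ut_a1 T)) => //; lia.
Qed.

(** The triangles [a b c] and [d b c] both have area [N] and share the side on [e2]. A second edge
    [h] through a third point of [e2] is constrained by both, and the two constraints on its single
    crossing with [e1] clash. *)
Lemma no_fan e1 e2 e3 a b c g :
  unit_triangle E N e1 e2 e3 a b c -> e1 (along a b 2) ->
  E g -> g (along a b 2) -> g c -> False.
Proof.
move=> T e1d Eg gd gc; set d := along a b 2 in e1d gd.
have [ab bc ca] := cross_neq0 (unit_triangle_neq0 T).
have Td : unit_triangle E N e1 e2 g d b c.
  apply: unit_triangle_sym; case: T => *; split=> //.
  suff -> : cross b d c = cross a b c by [].
  by rewrite /d /cross /along /=; ring.
have dE t : along d b t = along a b (2 - t).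
  by rewrite /d /along /=; congr (_, _); ring.
have one_point h s t : E h -> h <> e1 ->
    h (along a b s) -> e1 (along a b s) ->
    h (along a b t) -> e1 (along a b t) -> s = t.
  move=> Eh he hs es ht et; apply: contrapT => st; apply: he.
  by apply: (cs_uniq cs Eh (ut_E1 T) hs ht es et) => /(along_inj ab).
have neq12 := unit_triangle_edges_neq T.
have not_e1 h x : E h -> h x -> e2 x -> x <> b -> h <> e1.
  move=> Eh hx e2x xb he1; apply: neq12.
  by rewrite he1 in hx; apply: (cs_uniq cs (ut_E1 T) (ut_E2 T) hx (ut_b1 T) e2x (ut_b2 T)).
have [e2x|e2x] := unit_triangle_third (unit_triangle_rot T).
  have [h [Eh hx he2]] := cs_crossed cs (ut_E2 T) e2x.
  have he1 : h <> e1.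
    apply: (not_e1 h _ Eh hx e2x); rewrite -[X in _ <> X](along0 b c).
    by move/(along_inj bc).
  have [y [z [_ hz _ ez yz]]] :=
    menelaus2 (unit_triangle_rot T) Eh he2 e2x hx.
  have [y' [z' [_ hz' _ ez' yz']]] :=
    menelaus2 (unit_triangle_rot Td) Eh he2 e2x hx.
  rewrite dE in hz' ez'.
  (* Both [z] and [z'] lie in {0, -2, -3}, so [2 - z'] is positive and [z] is not. *)
  have eqz : z = 2 - z' by apply: (one_point h).
  by case: yz yz' => -[_ ?] [] [_ ?]; lia.
have [h [Eh hx he2]] := cs_crossed cs (ut_E2 T) e2x.
have he1 : h <> e1.
  apply: (not_e1 h _ Eh hx e2x); rewrite -[X in _ <> X](along1 c b).
  by move/(along_inj (nesym bc)).
have Tc := unit_triangle_rot (unit_triangle_rot (unit_triangle_sym T)).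
have Tcd := unit_triangle_sym (unit_triangle_rot Td).
have [y [z [hy _ ey _ yz]]] := menelaus2 Tc Eh he2 e2x hx.
have [y' [z' [hy' _ ey' _ yz']]] := menelaus2 Tcd Eh he2 e2x hx.
rewrite alongC in hy ey.
rewrite alongC dE in hy' ey'.
(* Both [y] and [y'] lie in {1, -2, -3}: the left side is 0, 3 or 4, the right side 2, -1 or -2. *)
have eqy : 1 - y = 2 - (1 - y') by apply: (one_point h).
by case: yz yz' => -[? _] [] [? _]; lia.
Qed.

Lemma no_unit_triangle_third e1 e2 e3 a b c :
  unit_triangle E N e1 e2 e3 a b c -> ~ e1 (along a b 2).
Proof.
move=> T e1d.
have [g [Eg gd ge1]] := cs_crossed cs (ut_E1 T) e1d.
have [y [z [gy _ ey _ yz]]] := menelaus2 T Eg ge1 e1d gd.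
have yb : y = -2 \/ y = -3.
  case: yz => -[y1 _]; [|by left|by right].
  by rewrite y1 along1 in gy; case: (no_fan T e1d Eg gd gy).
(* The point [2b - c] has coordinate -1 on [b c], between 0 and [y]. *)
have e2x : e2 (along c b 2).
  rewrite alongC.
  by apply: (along_convex (t := y) cs (ut_E2 T) (ut_b2 T)) => //; lia.
have [h [Eh hx he2]] := cs_crossed cs (ut_E2 T) e2x.
have Tc := unit_triangle_rot (unit_triangle_rot (unit_triangle_sym T)).
have [y' [z' [hy' _ _ _ yz']]] := menelaus2 Tc Eh he2 e2x hx.
have yb' : y' = -2 \/ y' = -3.
  case: yz' => -[y1 _]; [|by left|by right].
  by rewrite y1 along1 in hy'; case: (no_fan Tc e2x Eh hx hy').
have [x gX hX] := cs_meet cs Eg Eh.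
have colg := cs_collinear cs Eg gd gy gX.
have colh := cs_collinear cs Eh hx hy' hX.
(* Up to the factor [cross a b c], the numbers [cross a x c] and [cross a b x] are the coordinates
   of [x] with origin [a] and basis [b - a], [c - a]; the two equations are the lines of [g] and
   [h]. *)
have : - (1 + y) * cross a b x - y * cross a x c + 2 * y * cross a b c = 0.
  by rewrite -colg /cross /along /=; ring.
have : - (1 + y') * cross a b x - cross a x c + (1 - y') * cross a b c = 0.
  by rewrite -colh /cross /along /=; ring.
have := unit_triangle_neq0 T; have := ut_area T.
have [_ /(_ _ _ _ _ x (ut_E1 T) Eg (ut_a1 T) (ut_b1 T) gX)] := minN.
move: (cross a b x) (cross a x c) (cross a b c) => u v w.
(* The solutions are [u = - k w] with [k] equal to 2/3, 4/5, 3/5 or 3/4, so the area is nonzero and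
   less than [N]. *)
by case: yb yb' => -> [] ->; lia.
Qed.

Lemma no_unit_triangle e1 e2 e3 a b c : ~ unit_triangle E N e1 e2 e3 a b c.
Proof.
move=> T; have [] := unit_triangle_third T.
  exact: no_unit_triangle_third T.
exact: no_unit_triangle_third (unit_triangle_sym T).
Qed.

(** * Existence of a triangle of minimal area on three edges *)

(** Either the point at [i + 1] is the one at [j], or its second edge [g] passes through [s]; both
    ways the points at [i] and [i + 1] form the triangle with [s]. *)
Lemma unit_triangle_of_apex e f f' p q s i j :
  E e -> E f -> E f' -> e p -> e q -> f s -> f' s -> f <> f' ->
  `|cross p q s| = N -> e (along p q i) -> f (along p q i) ->
  e (along p q j) -> f' (along p q j) -> i < j ->
  exists e1 e2 e3 a b c, unit_triangle E N e1 e2 e3 a b c.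
Proof.
move=> Ee Ef Ef' ep eq_ fs fs' ff' area ei fi ej fj ij.
have N0 : 0 < N by case: minN.
have pqs : cross p q s <> 0 by lia.
have [pq qs sp] := cross_neq0 pqs.
have ebetween m : i <= m <= j -> e (along p q m).
  move=> imj; apply: (cs_convex (m := m - i) (n := j - i) cs Ee ei ej);
    [lia|lia|by rewrite /=; ring|by rewrite /=; ring].
have eZ : e (along p q (i + 1)) by apply: ebetween; lia.
have areaZ : `|cross (along p q i) (along p q (i + 1)) s| = N.
  by rewrite -area; congr `|_|; rewrite /cross /=; ring.
have [ji|ji] := eqVneq j (i + 1).
  exists e, f', f, (along p q i), (along p q (i + 1)), s; split=> //.
  by rewrite -ji.
have [g [Eg gZ ge]] := cs_crossed cs Ee eZ.
have [gs|gs] := pselect (g s).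
  by exists e, g, f, (along p q i), (along p q (i + 1)), s; split.
exfalso.
(* An edge [g] missing [s] would separate [i] from [j] on [e], but a line at
   integer positions [t], [t'] cannot cut just one other side. *)
have g_other m : m <> i + 1 -> e (along p q m) -> ~ g (along p q m).
  move=> mi em gm; apply: ge; apply: (cs_uniq cs Eg Ee gm gZ em eZ).
  by move/(along_inj pq).
have [Y gY fY] := cs_meet cs Eg Ef.
have [Y' gY' fY'] := cs_meet cs Eg Ef'.
(* Coordinates on [f] start at the point [i], those on [f'] at the point [j]; both take the value 1
   at [s]. *)
have area1 : `|cross (along p q i) s (along p q (i + 1))| = N.
  by rewrite -area -normrN; congr `|_|; rewrite /cross /=; ring.
have [t Yt] := min_area_step cs minN Ef Ee fi fs eZ fY area1.
have eW : e (along p q (j - 1)) by apply: ebetween; lia.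
have area2 : `|cross (along p q j) s (along p q (j - 1))| = N.
  by rewrite -area; congr `|_|; rewrite /cross /=; ring.
have [t' Yt'] := min_area_step cs minN Ef' Ee fj fs' eW fY' area2.
rewrite {}Yt in gY; rewrite {}Yt' in gY'.
have t0 : t <> 0.
  by move=> t0; rewrite t0 along0 in gY; apply: (g_other i) => //; lia.
have t1 : t <> 1 by move=> t1; rewrite t1 along1 in gY.
have t0' : t' <> 0.
  by move=> t0'; rewrite t0' along0 in gY'; apply: (g_other j) => //; lia.
have t1' : t' <> 1 by move=> t1'; rewrite t1' along1 in gY'.
have := cs_collinear cs Eg gZ gY' gY.
have -> : cross (along p q (i + 1)) (along (along p q j) s t')
    (along (along p q i) s t) =
  cross p q s * ((j - i - 1) * t * (1 - t') + t' * (1 - t)).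
  by rewrite /cross /along /=; ring.
move=> /mulf_eq0_cancel /(_ pqs).
have k0 : 0 < j - i - 1 by lia.
move: (j - i - 1) k0 => k k0.
(* Since [t] and [t'] avoid 0 and 1, the products [t (1 - t')] and [t' (1 - t)] are nonzero of equal
   sign, and [k] is positive, so the sum cannot vanish. *)
have [?|?] : 2 <= t \/ t <= -1 by lia.
  have [?|?] : 2 <= t' \/ t' <= -1 by lia.
    by nia.
  by nia.
have [?|?] : 2 <= t' \/ t' <= -1 by lia.
  by nia.
by nia.
Qed.

(** As [s] is off [e], a second edge [f'] through [s] meets [e] in another point than [f] does; the
    two crossings are then ordered by coordinate. *)
Lemma exists_unit_triangle e f p q s :
  E e -> E f -> e p -> e q -> f s -> `|cross p q s| = N ->
  exists e1 e2 e3 a b c, unit_triangle E N e1 e2 e3 a b c.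
Proof.
move=> Ee Ef ep eq_ fs area.
have N0 : 0 < N by case: minN.
have pqs : cross p q s <> 0 by lia.
have [pq _ _] := cross_neq0 pqs.
have es : ~ e s by move=> es; apply: pqs; apply: (cs_collinear cs Ee).
have [f' [Ef' fs' ff']] := cs_crossed cs Ef fs.
have [P eP fP] := cs_meet cs Ee Ef.
have [Q eQ fQ] := cs_meet cs Ee Ef'.
have PQ : P <> Q.
  move=> PQ; apply: ff'; rewrite -PQ in fQ.
  by apply: (cs_uniq cs Ef' Ef fs' fQ fs fP) => sP; apply: es; rewrite sP.
have [i Pi] := min_area_step cs minN Ee Ef ep eq_ fs eP area.
have [j Qj] := min_area_step cs minN Ee Ef ep eq_ fs eQ area.
rewrite {}Pi in eP fP PQ; rewrite {}Qj in eQ fQ PQ.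
have [ij|ji] : i < j \/ j < i.
- have [ij|?] := eqVneq i j; last lia.
  by rewrite ij in PQ.
- exact: (unit_triangle_of_apex Ee Ef Ef' ep eq_ fs fs' (nesym ff') area eP fP eQ fQ).
- exact: (unit_triangle_of_apex Ee Ef' Ef ep eq_ fs' fs ff' area eQ fQ eP fP).
Qed.

End Triangle.

(** Two distinct edges through one point span a positive area, and areas are integers, so a least
    positive one exists and is attained. *)
Lemma crossing_system_false E : ~ crossing_system E.
Proof.
move=> cs; have [e Ee] := cs_nonempty cs.
have [p ep _] := cs_meet cs Ee Ee.
have [f [Ef fp fe]] := cs_crossed cs Ee ep.
have [q [eq_ qp _]] := cs_third cs Ee ep ep.
have [s [fs sp _]] := cs_third cs Ef fp fp.
pose area n := `[< exists e f p q s,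
  [/\ [/\ E e, E f, e p, e q & f s], (0 < n)%N & `|cross p q s|%N = n] >].
have ex_area : exists n, area n.
  exists `|cross p q s|%N; apply/asboolP; exists e, f, p, q, s; split=> //.
  rewrite absz_gt0; apply/eqP => pqs; apply: fe; apply/esym.
  exact: (cs_line cs Ee Ef ep eq_ (nesym qp) fp fs).
case: (ex_minnP ex_area) => n /asboolP[].
move=> {e f p q s Ee Ef ep eq_ fs fp fe qp sp} e [f [p [q [s]]]].
move=> [[Ee Ef ep eq_ fs] n0 hn] n_min.
have minN : min_area E n%:Z.
  split=> // e' f' p' q' s' Ee' Ef' ep' eq' fs' pqs.
  have : (n <= `|cross p' q' s'|)%N.
    apply: n_min; apply/asboolP; exists e', f', p', q', s'; split=> //.
    by rewrite absz_gt0; apply/eqP.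
  lia.
have hn' : `|cross p q s| = n%:Z by lia.
have [e1 [e2 [e3 [a [b [c T]]]]]] :=
  exists_unit_triangle cs minN Ee Ef ep eq_ fs hn'.
exact: (no_unit_triangle cs minN T).
Qed.

(** * From segment hypergraphs to crossing systems *)

Lemma card_gt2_third (T : eqType) (e : set T) (r : nat) (p q : T) :
  (3 <= r)%N -> e #= `I_r -> exists s, [/\ e s, s <> p & s <> q].
Proof.
case: r => [|[|[|r]]] // _ /eq_cardSP[x ex] /eq_cardSP[y [ey yx]].
move=> /eq_cardSP[z [[ez zx] zy] _]; move: yx zx zy => /= yx zx zy.
have [xp|xp] := eqVneq x p.
  have [yq|/eqP yq] := eqVneq y q.
    by exists z; split; rewrite -?xp -?yq.
  by exists y; split=> //; rewrite -xp.
have [xq|/eqP xq] := eqVneq x q; last by exists x; split=> //; exact/eqP.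
have [yp|/eqP yp] := eqVneq y p; last by exists y; split=> //; rewrite -xq.
by exists z; split; rewrite -?xq -?yp.
Qed.

Lemma line_collinear (R : realType) (L : set (R * R)) (p q s : point) :
  is_line L -> L (to_plane R p) -> L (to_plane R q) -> L (to_plane R s) ->
  cross p q s = 0.
Proof.
case=> a [b [c [ab ->]]]; rewrite /to_plane /= => Lp Lq Ls.
apply/eqP; rewrite -(intr_eq0 R); apply/eqP.
rewrite /cross rmorphB !rmorphM !rmorphB /=.
set p1 : R := p.1%:~R; set p2 : R := p.2%:~R; set q1 : R := q.1%:~R.
set q2 : R := q.2%:~R; set s1 : R := s.1%:~R; set s2 : R := s.2%:~R.
rewrite -/p1 -/p2 -/q1 -/q2 -/s1 -/s2 in Lp Lq Ls *.
set k := (X in X = 0).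
(* The normal [(a, b)] is orthogonal to [q - p] and [s - p], whose determinant is [k]; Cramer's rule
   gives [a k = b k = 0]. *)
have ak : a * k = 0.
  have -> : a * k = (a * q1 + b * q2 - (a * p1 + b * p2)) * (s2 - p2)
    - (a * s1 + b * s2 - (a * p1 + b * p2)) * (q2 - p2) by rewrite /k; ring.
  by rewrite Lp Lq Ls; ring.
have bk : b * k = 0.
  have -> : b * k = (a * s1 + b * s2 - (a * p1 + b * p2)) * (q1 - p1)
    - (a * q1 + b * q2 - (a * p1 + b * p2)) * (s1 - p1) by rewrite /k; ring.
  by rewrite Lp Lq Ls; ring.
apply: contrapT => /eqP k0; move: ab; rewrite xpair_eqE.
move: ak bk => /eqP; rewrite mulf_eq0 (negbTE k0) orbF => -> /eqP.
by rewrite mulf_eq0 (negbTE k0) orbF => ->.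
Qed.

Lemma collinear_line (R : realType) (L : set (R * R)) (p q s : point) :
  is_line L -> L (to_plane R p) -> L (to_plane R q) -> p <> q ->
  cross p q s = 0 -> L (to_plane R s).
Proof.
case=> a [b [c [_ ->]]]; rewrite /to_plane /= => Lp Lq /point_neq pq k0.
have {}k0 : (cross p q s)%:~R = 0 :> R by rewrite k0.
have : (q.1 - p.1)%:~R <> 0 :> R \/ (q.2 - p.2)%:~R <> 0 :> R.
  case: pq => pq; [left|right]; apply/eqP; rewrite intr_eq0; exact/eqP.
move: k0; rewrite /cross rmorphB !rmorphM !rmorphB /=.
set p1 : R := p.1%:~R; set p2 : R := p.2%:~R; set q1 : R := q.1%:~R.
set q2 : R := q.2%:~R; set s1 : R := s.1%:~R; set s2 : R := s.2%:~R.
rewrite -/p1 -/p2 -/q1 -/q2 in Lp Lq *.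
set k := (X in X = 0) => k0 {}pq.
apply/subr0_eq; case: pq => pq; apply: mulf_eq0_cancel pq.
  transitivity ((s1 - p1) * (a * q1 + b * q2 - (a * p1 + b * p2)) + b * k
      + (q1 - p1) * (a * p1 + b * p2 - c)); first by rewrite /k; ring.
  by rewrite Lp Lq k0; ring.
transitivity ((s2 - p2) * (a * q1 + b * q2 - (a * p1 + b * p2)) - a * k
    + (q2 - p2) * (a * p1 + b * p2 - c)); first by rewrite /k; ring.
by rewrite Lp Lq k0; ring.
Qed.

Lemma segment_to_plane (R : realType) (p q z : point) (m n : int) :
  0 <= m <= n -> 0 < n ->
  n * (z.1 - p.1) = m * (q.1 - p.1) -> n * (z.2 - p.2) = m * (q.2 - p.2) ->
  segment (to_plane R p) (to_plane R q) (to_plane R z).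
Proof.
move=> /andP[m0 mn] n0 z1 z2.
have nR : (0 : R) < n%:~R by rewrite ltr0z.
exists (m%:~R / n%:~R); split.
  rewrite divr_ge0 ?ler0z ?(ltW n0) //=.
  by rewrite ler_pdivrMr // mul1r ler_int.
have nR0 : (n%:~R : R) != 0 by rewrite gt_eqF.
rewrite /to_plane /=; congr (_, _); apply: (mulfI nR0).
  have /= := congr1 (intr : int -> R) z1; rewrite !rmorphM !rmorphB /= => h.
  by transitivity (n%:~R * p.1%:~R + m%:~R * (q.1%:~R - p.1%:~R) : R);
    [rewrite -h; ring|field].
have /= := congr1 (intr : int -> R) z2; rewrite !rmorphM !rmorphB /= => h.
by transitivity (n%:~R * p.2%:~R + m%:~R * (q.2%:~R - p.2%:~R) : R);
  [rewrite -h; ring|field].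
Qed.

(** Disjoint [e] and [f] are distinct because [e] is nonempty, so they would form a matching of size
    2. *)
Lemma intersecting_meet (T : Type) (H : hypergraph T) (e f : set T) :
  intersecting H -> e !=set0 -> edges H e -> edges H f ->
  exists2 p, e p & f p.
Proof.
move=> [_ small] [x ex] Ee Ef.
have [[p [ep fp]]|disj] := pselect (e `&` f !=set0); first by exists p.
have ef0 : e `&` f = set0 by apply/nonemptyPn.
have ef : e <> f by move=> ef; apply: disj; exists x; rewrite -ef.
have M2 : is_matching H [set e; f].
  split; first by move=> _ [->|->].
  by move=> _ _ [->|->] [->|->] //; rewrite setIC.
have : [set e; f] #= `I_2.
  apply/eq_cardSP; exists e; first by left.
  have -> : [set e; f] `\ e = [set f].
    apply/seteqP; split=> [g [[->|->]] // /(_ erefl) //|g ->].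
    by split; [right|exact: nesym].
  exact: card_set1.
by rewrite card_eq_le => /andP[_ /card_le_trans /(_ (small _ M2))]; rewrite card_le_II.
Qed.

Lemma segment_hypergraph_third (R : realType) r (H : hypergraph point) e p q :
  (3 <= r)%N -> segment_hypergraph R r H -> edges H e ->
  exists s, [/\ e s, s <> p & s <> q].
Proof.
by move=> hr [+ _] Ee => /(_ e Ee)[L _ [_ card _]]; exact: card_gt2_third card.
Qed.

Lemma segment_hypergraph_meet (R : realType) r (H : hypergraph point) e f :
  (3 <= r)%N -> segment_hypergraph R r H -> intersecting H ->
  edges H e -> edges H f -> exists2 p, e p & f p.
Proof.
move=> hr Hseg Hint Ee; apply: intersecting_meet => //.
have [s [es _ _]] := segment_hypergraph_third (0, 0) (0, 0) hr Hseg Ee.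
by exists s.
Qed.

Lemma segment_crossing_system (R : realType) r (H : hypergraph point) :
  (3 <= r)%N -> segment_hypergraph R r H -> intersecting H ->
  ~ (exists v, isolated_vertex H v) -> crossing_system (edges H).
Proof.
move=> hr Hseg Hint noiso; split.
- have [M [ME _] /eq_cardSP[e Me _]] := Hint.1.
  by exists e; exact: ME.
- by move=> e f; exact: segment_hypergraph_meet Hseg Hint.
- move=> e f p q s Ee Ef ep eq_ pq fp fs sp pqs.
  have [L Lline [eL _ _]] := Hseg.1 _ Ee.
  have [L' L'line [fL' _ _]] := Hseg.1 _ Ef.
  apply: (Hseg.2 L Lline) => // x fx.
  (* The line of [e] contains [p] and [s], hence all of [f], and a line carries at most one edge. *)
  have Ls := collinear_line Lline (eL _ ep) (eL _ eq_) pq pqs.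
  apply: (collinear_line Lline (eL _ ep) Ls (nesym sp)).
  exact: (line_collinear L'line (fL' _ fp) (fL' _ fs) (fL' _ fx)).
- move=> e p q s Ee ep eq_ es; have [L Lline [eL _ _]] := Hseg.1 _ Ee.
  exact: (line_collinear Lline (eL _ ep) (eL _ eq_) (eL _ es)).
- move=> e p q z m n Ee ep eq_ mn n0 z1 z2.
  have [L _ [_ _ econv]] := Hseg.1 _ Ee.
  by apply: (econv p q) => //; exact: (segment_to_plane R mn n0 z1 z2).
- by move=> e p q Ee _ _; exact: segment_hypergraph_third Hseg Ee.
- move=> e p Ee ep; apply: contrapT => nof; apply: noiso; exists p.
  split; first exact: edges_sub ep.
  exists e; split=> // f [Ef fp]; apply: contrapT => ef; apply: nof.
  by exists f; split=> //; exact: nesym.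
Qed.

(** * The covering number and the conclusion *)

(** The witness is the least size of a finite cover; an infinite cover dominates every [I_t]. *)
Lemma covering_number_le (T : Type) (H : hypergraph T) (n : nat) C :
  is_cover H C -> C #= `I_n -> exists2 t, covering_number H t & (t <= n)%N.
Proof.
move=> Ccov Cn.
pose covered m := `[< exists2 D, is_cover H D & D #= `I_m >].
have ex : exists m, covered m by exists n; apply/asboolP; exists C.
case: (ex_minnP ex) => t /asboolP tcov tmin.
exists t; last by apply: tmin; apply/asboolP; exists C.
split=> // D Dcov.
have [/finite_setP[m Dm]|Dinf] := pselect (finite_set D).
  move: (Dm); rewrite card_eq_le => /andP[_]; apply: card_le_trans.
  by rewrite card_le_II; apply: tmin; apply/asboolP; exists D.
by apply: card_le_trans (iffLR (infiniteP D) Dinf); exact: subset_card_le.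
Qed.

Theorem theorem3p3 (R : realType) (r : nat) (hr : (3 <= r)%N)
    (H : hypergraph (int * int)) (Hseg : segment_hypergraph R r H)
    (Hint : intersecting H) :
  (exists v : int * int, isolated_vertex H v) /\
  (exists2 t : nat, covering_number H t & (t <= r - 1)%N).
Proof.
have [v isov] : exists v, isolated_vertex H v.
  apply: contrapT => noiso.
  exact: crossing_system_false (segment_crossing_system hr Hseg Hint noiso).
split; first by exists v.
have [_ [e [[Ee ev] e_uniq]]] := isov.
(* Only [e] contains [v], so every other edge meets [e] away from [v], and [e] itself has further
   points. *)
have ecov : is_cover H (e `\ v).
  split=> [x [ex _]|f Ef]; first exact: edges_sub ex.
  have [fv|fv] := pselect (f v).
    have [s [es sv _]] := segment_hypergraph_third v v hr Hseg Ee.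
    by exists s; split; first by rewrite -(e_uniq f).
  have [x ex fx] := segment_hypergraph_meet hr Hseg Hint Ee Ef.
  by exists x; split=> //; split=> // xv; apply: fv; rewrite -xv.
have [L _ [_ er _]] := Hseg.1 _ Ee.
have [n en] : exists n, e `\ v #= `I_n.
  by apply/finite_setP/finite_setD; apply/finite_setP; exists r.
have eSn : e #= `I_n.+1 by apply/eq_cardSP; exists v.
have [t tcov tn] := covering_number_le ecov en.
exists t => //.
have : `I_n.+1 #<= `I_r.
  move: eSn er; rewrite !card_eq_le => /andP[_ ne] /andP[er _].
  exact: card_le_trans ne er.
rewrite card_le_II; lia.
Qed.
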